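(* The Maximum Strong Transitivity Problem (MSTP) can be solved in linear time for split graphs. That is, MSTP restricted to input graphs $G=(V,E)$ that are split graphs is solvable by an algorithm with running time $O(|V|+|E|)$.
   Context: All graphs are finite, simple and undirected; $\deg_G(x)$ is the degree of $x$ in $G$. A graph is a split graph if its vertex set can be partitioned into an independent set $S$ and a clique $K$. For disjoint $A,B\subseteq V$, $A$ strongly dominates $B$ if for every $y\in B$ there is $x\in A$ with $xy\in E$ and $\deg_G(x)\ge \deg_G(y)$. A strong transitive partition of $G$ of order (size) $k$ is a partition $\{V_1,V_2,\ldots,V_k\}$ of $V$ into nonempty (ordered) parts such that $V_i$ strongly dominates $V_j$ for all $1\le i<j\le k$. The strong transitivity $Tr_{st}(G)$ is the maximum order of a strong transitive partition of $G$. MSTP is the optimization problem whose instance is a graph $G$, whose feasible solutions are the strong transitive partitions of $G$, and whose measure, to be maximized, is the order of the partition (so that the optimum value is $Tr_{st}(G)$). *)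

(* Defs.v *)
From mathcomp Require Import all_boot.

Set Implicit Arguments.
Unset Strict Implicit.
Unset Printing Implicit Defensive.

Section Graphs.
Variables (T : finType) (e : rel T).
Implicit Types (A B S K : {set T}) (P Q : seq {set T}).

Definition simple_graph : Prop := symmetric e /\ irreflexive e.

Definition edges : {set {set T}} :=
  [set [set p.1; p.2] | p : T * T & e p.1 p.2].

Definition deg (x : T) : nat := #|[set y | e x y]|.

Definition independent S : Prop := {in S &, forall x y, ~~ e x y}.

Definition clique K : Prop := {in K &, forall x y, x != y -> e x y}.

Definition split_graph : Prop :=
  exists S K, [/\ S :|: K = [set: T], [disjoint S & K],
                  independent S & clique K].

Definition strongly_dominates A B : Prop :=
  forall y, y \in B -> exists2 x, x \in A & e x y /\ deg y <= deg x.

(* The ordered parts are listed in P; the order of the partition is [size P].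
   [partition] makes the parts nonempty, pairwise disjoint and covering, and
   [uniq] ensures that no part is listed twice. *)
Definition strong_transitive_partition P : Prop :=
  [/\ uniq P, partition [set A in P] [set: T]
    & forall i j, i < j -> j < size P ->
        strongly_dominates (nth set0 P i) (nth set0 P j)].

Definition maximum_strong_transitive_partition P : Prop :=
  strong_transitive_partition P /\
  forall Q, strong_transitive_partition Q -> size Q <= size P.

End Graphs.

(* Unit-cost random access machine with registers and an indirectly addressed
   memory, both indexed by and containing natural numbers.  A word holds a value
   in [0, W]: an instruction that would create a larger value is stuck.  Taking
   W linear in the input size gives words of logarithmically many bits, which
   rules out packing large data into one cell.  Multiplication is deliberately
   absent, and subtraction is truncated at 0. *)

Inductive instr : Type :=
| Const (d c : nat)
| Add (d a b : nat)
| Sub (d a b : nat)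
| Read (d a : nat)
| Write (a b : nat)
| Jump (l : nat)
| JumpLt (a b l : nat)
| Halt.

Definition program := seq instr.

Record state := State {
  pc : nat;
  regs : nat -> nat;
  memory : nat -> nat
}.

Definition upd (f : nat -> nat) (a v : nat) : nat -> nat :=
  fun x => if x == a then v else f x.

Definition set_reg (s : state) (d v : nat) : state :=
  State (pc s).+1 (upd (regs s) d v) (memory s).

(* A program counter beyond the end of the program behaves as [Halt]. *)
Definition fetch (p : program) (s : state) : instr := nth Halt p (pc s).

Definition halted (p : program) (s : state) : bool :=
  if fetch p s is Halt then true else false.

(* [None] means that no step is possible: halted, or word overflow. *)
Definition step (p : program) (W : nat) (s : state) : option state :=
  let R := regs s in
  let M := memory s in
  match fetch p s with
  | Const d c => if c <= W then Some (set_reg s d c) else None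
  | Add d a b =>
      if R a + R b <= W then Some (set_reg s d (R a + R b)) else None
  | Sub d a b => Some (set_reg s d (R a - R b))
  | Read d a => Some (set_reg s d (M (R a)))
  | Write a b => Some (State (pc s).+1 R (upd M (R a) (R b)))
  | Jump l => Some (State l R M)
  | JumpLt a b l => Some (State (if R a < R b then l else (pc s).+1) R M)
  | Halt => None
  end.

Definition run (p : program) (W t : nat) (s : state) : option state :=
  iter t (obind (step p W)) (Some s).

Definition initial_state (input : seq nat) : state :=
  State 0 (fun _ => 0) (nth 0 input).

Definition halts_within (p : program) (W t : nat) (input : seq nat)
    (s : state) : Prop :=
  exists2 t', t' <= t &
    run p W t' (initial_state input) = Some s /\ halted p s.

Section Encoding.
Variable n : nat.

(* Each list enumerates the neighbours of v once, in an arbitrary order. *)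
Definition adjacency_lists (e : rel 'I_n) (adj : 'I_n -> seq 'I_n) : Prop :=
  forall v, uniq (adj v) /\ adj v =i [set u | e v u].

(* The number of vertices, then the adjacency lists of the vertices 0, 1, ...,
   n - 1, where the neighbour u is written u + 1 and each list ends with 0. *)
Definition encode_graph (adj : 'I_n -> seq 'I_n) : seq nat :=
  n :: flatten [seq rcons [seq (val u).+1 | u <- adj v] 0 | v <- enum 'I_n].

(* M[0] is the order of the partition and M[v + 1] is the (one-based) index of
   the part of v. *)
Definition decode_partition (M : nat -> nat) : seq {set 'I_n} :=
  mkseq (fun i => [set v : 'I_n | M v.+1 == i.+1]) (M 0).

End Encoding.

(* Up to the multiplicative constant this is |V| + |E|; the summand 1 only
   matters for the graph without vertices. *)
Definition graph_size (n : nat) (e : rel 'I_n) : nat := n + #|edges e| + 1.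

(* Main.v *)
Require Import Defs.
From mathcomp Require Import all_boot.
From mathcomp Require Import zify.

(* A vertex of the last part of a strong transitive partition of order k has
   k - 1 distinct dominators, all of degree at least its own, hence at least
   k - 1; so k vertices have degree at least k - 1.  Let m be the largest k with
   that property.  In a split graph with independent set S and clique K, where
   K is maximal, m = |K|, and any m vertices of largest degree form a clique.
   List them by decreasing degree as x_1, ..., x_m: the partition with x_i in
   part i and all other vertices in part 1 is strong transitive of order m.
   The program computes the degrees, overwriting the adjacency lists already
   read, and then ranks the vertices by counting sort. *)

(** * Strong transitivity and vertex degrees *)

Section Bounds.
Variables (n : nat) (e : rel 'I_n).
Hypotheses (esym : symmetric e) (eirr : irreflexive e).

Definition card_deg_ge (d : nat) : nat := #|[set v | d <= deg e v]|.

Lemma size_strong_transitive_partition (Q : seq {set 'I_n}) k :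
  strong_transitive_partition e Q -> size Q = k.+1 -> k < card_deg_ge k.
Proof.
case=> uQ /and3P[_ tQ n0Q] domQ sQ.
have memQ i : i < k.+1 -> nth set0 Q i \in Q by rewrite -sQ; apply: mem_nth.
have /set0Pn[v vQ] : nth set0 Q k != set0.
  by apply: contraNneq n0Q => <-; rewrite inE memQ.
have dom (j : 'I_k) : exists x,
    [&& x \in nth set0 Q j, e v x & deg e v <= deg e x].
  have [||x xj [exv dvx]] := domQ j k _ _ v vQ; rewrite ?sQ ?ltn_ord //.
  by exists x; rewrite xj esym exv.
pose x j := xchoose (dom j).
have xP j : [&& x j \in nth set0 Q j, e v (x j) & deg e v <= deg e (x j)].
  exact: xchooseP (dom j).
have xinj : injective x.
  move=> i j xij; apply: val_inj => /=.
  have [xi _ _] := and3P (xP i); have [xj _ _] := and3P (xP j).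
  have ik : i < k.+1 by rewrite ltnW // ltnS ltn_ord.
  have jk : j < k.+1 by rewrite ltnW // ltnS ltn_ord.
  apply/eqP; rewrite -(nth_uniq set0 _ _ uQ) ?sQ //; apply: contraTT xi => nij.
  have /trivIsetP /(_ (nth set0 Q i) (nth set0 Q j)) := tQ.
  rewrite !inE !memQ // => /(_ isT isT nij) dij.
  by rewrite xij; apply: contraL xj => xi; rewrite (disjointFr dij xi).
(* The [k] dominators are distinct neighbours of [v], so [v] has degree at least [k], and so has
   each of them. As [v] is not its own neighbour, it is the remaining one of the [k.+1] vertices. *)
have kv : k <= deg e v.
  rewrite -[k]card_ord -(card_imset predT xinj); apply/subset_leq_card.
  by apply/subsetP => _ /imsetP[j _ ->]; rewrite inE; case/and3P: (xP j).
have vx : v \notin x @: predT.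
  apply/imsetP => -[j _ vxj]; case/and3P: (xP j) => _ + _.
  by rewrite -vxj eirr.
have <- : #|v |: x @: predT| = k.+1.
  by rewrite cardsU1 vx card_imset // card_ord.
apply/subset_leq_card/subsetP => u /setU1P[-> | /imsetP[j _ ->]].
  by rewrite inE.
by rewrite inE; case/and3P: (xP j) => _ _; apply: leq_trans.
Qed.

(** A vertex of [S] adjacent to all of [K] can be moved into [K]; repeating this shrinks [S], so it
    ends. *)
Lemma split_maximal_clique : split_graph e ->
  exists S K, [/\ S :|: K = [set: 'I_n], [disjoint S & K],
    independent e S, clique e K &
    forall s, s \in S -> exists2 x, x \in K & ~~ e s x].
Proof.
case=> S [K [SK dSK iS cK]].
have [m] := ubnP #|S|; elim: m => // m IHm in S K SK dSK iS cK * => Sm.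
have [/exists_inP[s sS /forall_inP sK] | noS] :=
    boolP [exists s in S, [forall x in K, e s x]]; last first.
  exists S, K; split=> // s sS; apply/exists_inP.
  by have := exists_inPn noS s sS; rewrite negb_forall_in.
apply: (IHm (S :\ s) (s |: K)).
- by rewrite setUA [_ :|: [set s]]setUC setD1K.
- rewrite disjoint_sym -setI_eq0 setIUl setU_eq0 setI_eq0 disjoints1 !inE eqxx /=.
  rewrite setI_eq0 disjoint_sym; apply: disjointWl dSK; exact: subsetDl.
- by move=> x y /setD1P[_ xS] /setD1P[_ yS]; apply: iS.
- move=> x y /setU1P[-> | xK] /setU1P[-> | yK]; rewrite ?eqxx // => xy.
  + exact: sK.
  + by rewrite esym; apply: sK.
  + exact: cK.
- by move: Sm; rewrite (cardsD1 s) sS.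
Qed.

(** With [K] maximal, degrees in [S] are below [#|K|] and degrees in [K] are at least [#|K|.-1], so
    [C] can differ from [K] only by exchanging vertices of nearly equal degree. It turns out that at
    most one vertex is exchanged. *)
Lemma top_degrees_clique (C : {set 'I_n}) m :
  split_graph e -> #|C| = m ->
  (forall d, d < card_deg_ge d -> d < m) ->
  (m > 0 -> m.-1 < card_deg_ge m.-1) ->
  (forall u v, u \in C -> v \notin C -> deg e v <= deg e u) ->
  clique e C.
Proof.
move=> /split_maximal_clique[S [K [SK dSK iS cK mS]]] cC mmax mge topC.
have SorK v : (v \in S) || (v \in K).
  by have := in_setT v; rewrite -SK inE.
have SK' v : v \in S -> v \notin K by move=> vS; rewrite (disjointFr dSK vS).
have degK v : v \in K -> #|K|.-1 <= deg e v.
  move=> vK; have -> : #|K|.-1 = #|K :\ v| by rewrite (cardsD1 v K) vK.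
  apply/subset_leq_card/subsetP => u /setD1P[uv uK].
  by rewrite inE cK // eq_sym.
have nbS v : v \in S -> [set u | e v u] \subset K.
  move=> vS; apply/subsetP => u; rewrite inE => evu.
  have /orP[uS|//] := SorK u.
  by have := iS _ _ vS uS; rewrite evu.
have degS v : v \in S -> deg e v < #|K|.
  move=> vS; have [x xK nvx] := mS v vS.
  apply: proper_card; apply/properP; split; first exact: nbS.
  by exists x; rewrite ?inE.
have degKS v u : v \in K -> u \in S -> e v u -> #|K| <= deg e v.
  move=> vK uS evu; have -> : #|K| = #|u |: K :\ v|.
    rewrite cardsU1 !inE (negPf (SK' _ uS)) andbF /=.
    by rewrite (cardsD1 v K) vK.
  apply/subset_leq_card/subsetP => w /setU1P[->|/setD1P[wv wK]].
    by rewrite inE.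
  by rewrite inE cK // eq_sym.
(* If [m] exceeded [#|K|], the vertices of degree at least [m.-1] would all lie in [K], which has
   too few. Conversely, [K] itself shows that [#|K|.-1] satisfies the condition in the definition of
   [m]. *)
have mK : m = #|K|.
  apply/eqP; rewrite eqn_leq; apply/andP; split.
    case: m {cC mmax} mge => // m /(_ isT) /= mge.
    rewrite ltnNge; apply/negP => Km; move: mge; rewrite ltnNge => /negP; apply.
    apply: leq_trans (Km); apply/subset_leq_card/subsetP => v.
    rewrite inE => mv; have /orP[vS|//] := SorK v.
    by have := leq_trans (degS v vS) (leq_trans Km mv); rewrite ltnn.
  have [-> // | K0] := posnP #|K|; rewrite -(prednK K0); apply: mmax.
  rewrite prednK //; apply/subset_leq_card/subsetP => v vK.
  by rewrite inE degK.
have cCK : #|C :\: K| = #|K :\: C|.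
  by apply/eqP; rewrite -(eqn_add2l #|C :&: K|) cardsID setIC cardsID cC mK.
(* A neighbour in [S] would raise the degree of [k] to [#|K|], above that of [u], although [u] was
   preferred to [k]. *)
have nCS u k : u \in C -> u \in S -> k \in K -> k \notin C -> ~~ e u k.
  move=> uC uS kK kC; apply/negP; rewrite esym => /(degKS k u kK uS) Kk.
  have := leq_trans Kk (topC u k uC kC).
  by rewrite leqNgt degS.
(* The neighbours of [u] lie in [K :\ k], and [u] has at least [deg e k >= #|K|.-1] of them, so they
   are all of [K :\ k]. *)
have CSK u k w : u \in C -> u \in S -> k \in K -> k \notin C ->
    w \in K -> w != k -> e u w.
  move=> uC uS kK kC wK wk; apply/negPn/negP => nuw.
  have := leq_trans (degK k kK) (topC u k uC kC).
  rewrite leqNgt (cardsD1 k K) kK /= ?add1n /= => /negP; apply.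
  apply: proper_card; apply/properP; split; last first.
    by exists w; rewrite !inE ?wk ?wK //.
  apply/subsetP => x; move: (subsetP (nbS u uS) x); rewrite !inE => xK ux.
  rewrite xK // andbT; apply: contraTneq ux => ->; exact: nCS.
have exK u : u \in C -> u \in S -> exists2 k, k \in K & k \notin C.
  move=> uC uS; have : 0 < #|C :\: K|.
    by apply/card_gt0P; exists u; rewrite inE SK'.
  by rewrite cCK => /card_gt0P[k /setDP[kK kC]]; exists k.
move=> u v uC vC uv.
have [uS | uS] := boolP (u \in S); have [vS | vS] := boolP (v \in S).
(* Two vertices of [C] in [S] would leave two vertices [k], [k'] of [K] outside [C]; then [u] is
   adjacent to [k'] by [CSK] and not adjacent to it by [nCS]. *)
- have : 1 < #|C :\: K|.
    by apply/card_gt1P; exists u, v; rewrite !inE !SK'.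
  rewrite cCK => /card_gt1P[k [k' [/setDP[kK kC] /setDP[kK' kC'] kk']]].
  have := nCS u k' uC uS kK' kC'.
  by rewrite (CSK u k k') // eq_sym.
- have [k kK kC] := exK u uC uS.
  apply: (CSK u k) => //; first by have := SorK v; rewrite (negPf vS).
  by apply: contraNneq kC => <-.
- have [k kK kC] := exK v vC vS; rewrite esym.
  apply: (CSK v k) => //; first by have := SorK u; rewrite (negPf uS).
  by apply: contraNneq kC => <-.
- apply: cK => //.
    by have := SorK u; rewrite (negPf uS).
  by have := SorK v; rewrite (negPf vS).
Qed.

End Bounds.

(** * Ranking by decreasing degree *)

Section Rank.
Variables (dg : nat -> nat) (n : nat).

Definition count_eq (d v : nat) := count (fun i => dg i == d) (iota 0 v).
Definition count_ge (d : nat) := count (fun i => d <= dg i) (iota 0 n).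

(* One-based position of i in the stable sort by decreasing degree. *)
Definition rank (i : nat) := count_ge (dg i).+1 + count_eq (dg i) i.+1.

Lemma count_eqS d v : count_eq d v.+1 = count_eq d v + (dg v == d).
Proof. by rewrite /count_eq -addn1 iotaD count_cat /= addn0. Qed.

Lemma count_eq_le d v : count_eq d v <= v.
Proof. by rewrite -[leqRHS](size_iota 0); apply: count_size. Qed.

Lemma count_ge_le d : count_ge d <= n.
Proof. by rewrite -[leqRHS](size_iota 0); apply: count_size. Qed.

(** The recurrence by which the program turns the counters into starting offsets. *)
Lemma count_geS d : count_ge d - count_eq d n = count_ge d.+1.
Proof.
suff -> : count_ge d = count_eq d n + count_ge d.+1 by rewrite addKn.
rewrite /count_ge /count_eq; elim: (iota 0 n) => //= i s ->.
by case: ltngtP => _; lia.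
Qed.

(* m = max {j + 1 | j < d, j < count_ge j}, or 0 if there is no such j. *)
Definition max_rank_spec (m d : nat) : Prop :=
  (0 < m -> m.-1 < count_ge m.-1) /\
  (forall j, j < d -> j < count_ge j -> j < m).

Lemma leq_count_eq d : {homo count_eq d : v w / v <= w}.
Proof.
move=> v w vw; rewrite -(subnK vw) addnC /count_eq iotaD count_cat; exact: leq_addr.
Qed.

Lemma leq_count_ge d d' : d <= d' -> count_ge d' <= count_ge d.
Proof. by move=> dd'; apply: sub_count => i /=; apply: leq_trans. Qed.

Lemma rankE i : rank i = (count_ge (dg i).+1 + count_eq (dg i) i).+1.
Proof. by rewrite /rank count_eqS eqxx addn1 addnS. Qed.

Lemma rank_gt0 i : 0 < rank i.
Proof. by rewrite rankE. Qed.

(** The vertices of degree [dg i] occupy one block of positions, which ends at [count_ge (dg i)]. *)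
Lemma rank_le_count_ge i : i < n -> rank i <= count_ge (dg i).
Proof.
move=> iN; have := count_geS (dg i); have := leq_count_eq (dg i) _ _ iN.
have := rank_gt0 i; rewrite /rank => ? ? ?.
have : count_eq (dg i) n <= count_ge (dg i).
  by apply: sub_count => j /= /eqP ->.
lia.
Qed.

Lemma rank_le i : i < n -> rank i <= n.
Proof. by move=> /rank_le_count_ge /leq_trans-> //; apply: count_ge_le. Qed.

Lemma rank_lt i j : i < n -> dg j < dg i -> rank i < rank j.
Proof.
move=> iN dji; apply: leq_ltn_trans (rank_le_count_ge i iN) _.
apply: leq_ltn_trans (leq_count_ge _ _ dji) _.
by rewrite rankE ltnS leq_addr.
Qed.

Lemma rank_lt_eq i j : i < j -> dg i = dg j -> rank i < rank j.
Proof.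
move=> ij dij; rewrite /rank dij ltn_add2l [count_eq _ j.+1]count_eqS eqxx addn1 ltnS.
exact: leq_count_eq.
Qed.

Lemma rank_inj i j : i < n -> j < n -> rank i = rank j -> i = j.
Proof.
move=> iN jN rij; case: (ltngtP (dg i) (dg j)) => dij.
- by have := rank_lt _ _ jN dij; rewrite rij ltnn.
- by have := rank_lt _ _ iN dij; rewrite rij ltnn.
case: (ltngtP i j) => // ij.
- by have := rank_lt_eq _ _ ij dij; rewrite rij ltnn.
- by have := rank_lt_eq _ _ ij (esym dij); rewrite rij ltnn.
Qed.

(** Shifted down by one, [rank] is an injection of ['I_n] into itself, hence a bijection. *)
Lemma rank_onto r : 0 < r <= n -> exists i : 'I_n, rank i = r.
Proof.
move=> /andP[r0 rn].
have lt_n (i : 'I_n) : (rank i).-1 < n by rewrite prednK ?rank_gt0 ?rank_le.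
have gI : injective (fun i => Ordinal (lt_n i)).
  move=> i j [/(congr1 S)]; rewrite !prednK ?rank_gt0 // => rij.
  by apply: val_inj; apply: rank_inj rij.
have [h _ hK] := injF_bij gI.
have r1 : r.-1 < n by rewrite prednK.
exists (h (Ordinal r1)); have /(congr1 val) /= := hK (Ordinal r1).
by have := rank_gt0 (h (Ordinal r1)); lia.
Qed.

Lemma card_rank_le m : m <= n -> #|[set i : 'I_n | rank i <= m]| = m.
Proof.
elim: m => [|m IHm] mn.
  by apply: eq_card0 => i; rewrite !inE leqNgt rank_gt0.
have [i ri] := rank_onto m.+1 mn.
rewrite (cardsD1 i) inE ri leqnn add1n; congr _.+1.
rewrite -[RHS](IHm (ltnW mn)); apply: eq_card => j; rewrite !inE.
case: (eqVneq j i) => [->|ji] /=; first by rewrite ri ltnn.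
rewrite [LHS]leq_eqVlt ltnS; case: eqP => //= rj.
by case/eqP: ji; apply: val_inj; apply: rank_inj; rewrite ?ltn_ord ?rj ?ri.
Qed.

End Rank.

(** * Optimality of the partition read from memory *)

Section Decode.
Variables (n : nat) (e : rel 'I_n) (dg : nat -> nat) (M : nat -> nat).
Hypotheses (gS : simple_graph e) (dgE : forall v : 'I_n, dg v = deg e v).

Lemma count_ge_deg d : count_ge dg n d = card_deg_ge n e d.
Proof.
rewrite /count_ge -val_enum_ord count_map /card_deg_ge cardE size_filter -enumT.
by apply: eq_count => v /=; rewrite inE dgE.
Qed.

Lemma decode_partition_maximum :
  split_graph e ->
  max_rank_spec dg n (M 0) n -> M 0 <= n ->
  (forall i, i < n ->
    M i.+1 = if M 0 < rank dg n i then 1 else rank dg n i) ->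
  maximum_strong_transitive_partition e (decode_partition n M).
Proof.
move: gS => [e_sym e_irr] splitG; set m := M 0 => -[mge mmax] mn Mr.
(* The range [d < n] covered by [max_rank_spec] contains every such [d], since [card_deg_ge n e d]
   is at most [n]. *)
have mmax' d : d < card_deg_ge n e d -> d < m.
  move=> dd; apply: mmax; rewrite ?count_ge_deg //.
  by apply: leq_trans dd _; rewrite -count_ge_deg count_ge_le.
have topC : clique e [set v : 'I_n | rank dg n v <= m].
  apply: (top_degrees_clique _ _ e_sym _ m) => //.
  - exact: card_rank_le.
  - by rewrite -count_ge_deg.
  - move=> u v; rewrite !inE -ltnNge -!dgE => um mv; rewrite leqNgt.
    apply/negP => /(rank_lt dg n _ _ (ltn_ord v)).
    by rewrite ltnNge (leq_trans um (ltnW mv)).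
have mem_part i (v : 'I_n) : i < m ->
    (v \in nth set0 (decode_partition n M) i) = (M v.+1 == i.+1).
  by move=> im; rewrite nth_mkseq // inE.
have part_ex i : i < m -> exists2 v : 'I_n, rank dg n v = i.+1 & M v.+1 = i.+1.
  move=> im; have [v rv] := rank_onto dg n i.+1 (leq_trans im mn).
  by exists v; rewrite ?Mr // rv ltnNge im.
(* As soon as there is a vertex, [j = 0] forces [0 < m], so part 1, which receives the vertices of
   rank above [m], exists. *)
have m0 (v : 'I_n) : 0 < m.
  apply: mmax; first exact: leq_ltn_trans (ltn_ord v).
  by rewrite /count_ge count_predT size_iota (leq_ltn_trans _ (ltn_ord v)).
have Mpos (v : 'I_n) : 0 < M v.+1 <= m.
  by rewrite Mr //; case: (ltnP m) => [_|->]; rewrite ?m0 ?rank_gt0.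
split; last first.
  move=> P stP; rewrite size_mkseq; case sP : (size P) => [//|k].
  apply: mmax'; exact: size_strong_transitive_partition sP.
have uP : uniq (decode_partition n M).
  apply/(uniqP set0) => i j; rewrite !inE size_mkseq => im jm ij.
  have [v _ vi] := part_ex i im.
  have := mem_part j v jm; rewrite -ij mem_part // vi eqxx => /esym/eqP[->] //.
split=> //.
- apply/and3P; split.
  + rewrite eqEsubset subsetT /=; apply/subsetP => v _.
    have /andP[v0 vm] := Mpos v.
    apply/bigcupP; exists [set u : 'I_n | M u.+1 == M v.+1]; last by rewrite inE.
    rewrite inE; apply/mapP; exists (M v.+1).-1; rewrite ?mem_iota prednK //.
  + apply/trivIsetP => A B; rewrite !inE => /mapP[i _ ->] /mapP[j _ ->] AB.
    rewrite -setI_eq0; apply: contraNT AB => /set0Pn[v].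
    by rewrite !inE => /andP[/eqP-> /eqP ->].
  + rewrite inE; apply/mapP => -[i]; rewrite mem_iota add0n => /andP[_ im] /esym/eqP.
    apply/negP/set0Pn; have [v _ vi] := part_ex i im; exists v.
    by rewrite inE vi.
move=> i j ij; rewrite size_mkseq => jm y.
have im := ltn_trans ij jm; rewrite mem_part // => /eqP yj.
(* Since [j] is positive, the part index [j.+1] is not the default 1, so it is a genuine rank. *)
have ry : rank dg n y = j.+1.
  by move: yj; rewrite Mr //; case: ltnP => // _ [j0]; rewrite -j0 in ij.
have [x rx xi] := part_ex i im; exists x; first by rewrite mem_part // xi.
split.
  apply: topC; rewrite ?inE ?rx ?ry //.
  by apply: contraTneq ij => xy; move: rx; rewrite xy ry => -[->]; rewrite ltnn.
rewrite -!dgE leqNgt; apply/negP => /(rank_lt dg n _ _ (ltn_ord y)).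
by rewrite rx ry ltnS ltnNge (ltnW ij).
Qed.

End Decode.


(** * The random access machine program *)

(* Registers: 0 and 1 hold constants, 2 is n, 3 the read position and then the
   base of the table of counters just after the input, 4 the loop index, 5 a
   degree, 7 the order m, 8 an address, 9 the number of vertices of degree at
   least the loop index.  The comments are instruction addresses. *)
Definition mstp_program : program := [::
  (* 0 *) Const 1 1; Read 2 0; Add 3 0 1;
  (* 3 *) JumpLt 4 2 5; Jump 15; Const 5 0;
  (* 6 *) Read 6 3; Add 3 3 1; JumpLt 0 6 10; Jump 12; Add 5 5 1; Jump 6;
  (* 12 *) Add 4 4 1; Write 4 5; Jump 3;
  (* 15 *) Const 4 0;
  (* 16 *) JumpLt 4 2 18; Jump 25; Add 4 4 1; Read 5 4; Add 8 3 5; Read 6 8;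
           Add 6 6 1; Write 8 6; Jump 16;
  (* 25 *) Const 4 0; Add 9 2 0;
  (* 27 *) JumpLt 4 2 29; Jump 38; Add 8 3 4; JumpLt 4 9 32; Jump 33;
           Add 7 4 1;
  (* 33 *) Read 6 8; Defs.Sub 9 9 6; Write 8 9; Add 4 4 1; Jump 27;
  (* 38 *) Const 4 0;
  (* 39 *) JumpLt 4 2 41; Jump 52; Add 4 4 1; Read 5 4; Add 8 3 5; Read 6 8;
           Add 6 6 1; Write 8 6; JumpLt 7 6 49; Jump 50; Const 6 1;
  (* 50 *) Write 4 6; Jump 39;
  (* 52 *) Write 0 7; Halt].

(** * Execution rules for the machine *)

Section Exec.
Variables (p : program) (W : nat) (Q : state -> Prop).

(* The lists l prescribe the first registers.  Loops are specified in
   continuation-passing style: [exec] at the exit implies [exec] at the entry. *)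
Definition exec (t i : nat) (l : seq nat) (M : nat -> nat) : Prop :=
  forall R, (forall a, a < size l -> R a = nth 0 l a) ->
  exists2 t', t' <= t & exists2 s, run p W t' (State i R M) = Some s & Q s.

Lemma exec_weaken t t' i l M : t <= t' -> exec t i l M -> exec t' i l M.
Proof.
move=> tt' ex R /ex[t0 t0t Qs]; exists t0 => //; exact: leq_trans tt'.
Qed.

Lemma exec_done t i l M :
  (forall R, (forall a, a < size l -> R a = nth 0 l a) -> Q (State i R M)) ->
  exec t i l M.
Proof.
by move=> Qs R Rl; exists 0 => //; exists (State i R M) => //; apply: Qs.
Qed.

Lemma exec_step t i l M i' l' M' :
  (forall R, (forall a, a < size l -> R a = nth 0 l a) ->
    exists2 R', forall a, a < size l' -> R' a = nth 0 l' a
    & step p W (State i R M) = Some (State i' R' M')) ->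
  exec t i' l' M' -> exec t.+1 i l M.
Proof.
move=> st ex R /st[R' /ex[t' t't [s rs Qs]] Rs].
exists t'.+1 => //; exists s => //.
by rewrite /run iterSr /= Rs.
Qed.

Lemma upd_nth l R d v : d < size l ->
  (forall a, a < size l -> R a = nth 0 l a) ->
  forall a, a < size (set_nth 0 l d v) ->
    upd R d v a = nth 0 (set_nth 0 l d v) a.
Proof.
move=> dl Rl a; rewrite size_set_nth (maxn_idPr dl) => al.
by rewrite nth_set_nth /= /upd; case: eqP => // _; apply: Rl.
Qed.

Lemma exec_const t i l M d c :
  nth Halt p i = Const d c -> d < size l -> c <= W ->
  exec t i.+1 (set_nth 0 l d c) M -> exec t.+1 i l M.
Proof.
move=> pi dl cW; apply: exec_step => R Rl; exists (upd R d c).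
  exact: upd_nth.
by rewrite /step /fetch /= pi cW.
Qed.

Lemma exec_add t i l M d a b :
  nth Halt p i = Add d a b -> [&& d < size l, a < size l & b < size l] ->
  nth 0 l a + nth 0 l b <= W ->
  exec t i.+1 (set_nth 0 l d (nth 0 l a + nth 0 l b)) M -> exec t.+1 i l M.
Proof.
move=> pi /and3P[dl al bl] cW; apply: exec_step => R Rl.
exists (upd R d (nth 0 l a + nth 0 l b)); first exact: upd_nth.
by rewrite /step /fetch /= pi !Rl ?cW.
Qed.

Lemma exec_sub t i l M d a b :
  nth Halt p i = Defs.Sub d a b -> [&& d < size l, a < size l & b < size l] ->
  exec t i.+1 (set_nth 0 l d (nth 0 l a - nth 0 l b)) M -> exec t.+1 i l M.
Proof.
move=> pi /and3P[dl al bl]; apply: exec_step => R Rl.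
exists (upd R d (nth 0 l a - nth 0 l b)); first exact: upd_nth.
by rewrite /step /fetch /= pi !Rl.
Qed.

Lemma exec_read t i l M d a :
  nth Halt p i = Read d a -> (d < size l) && (a < size l) ->
  exec t i.+1 (set_nth 0 l d (M (nth 0 l a))) M -> exec t.+1 i l M.
Proof.
move=> pi /andP[dl al]; apply: exec_step => R Rl.
exists (upd R d (M (nth 0 l a))); first exact: upd_nth.
by rewrite /step /fetch /= pi !Rl.
Qed.

Lemma exec_write t i l M a b :
  nth Halt p i = Write a b -> (a < size l) && (b < size l) ->
  exec t i.+1 l (upd M (nth 0 l a) (nth 0 l b)) -> exec t.+1 i l M.
Proof.
move=> pi /andP[al bl]; apply: exec_step => R Rl; exists R => //.
by rewrite /step /fetch /= pi !Rl.
Qed.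

Lemma exec_jump t i l M j :
  nth Halt p i = Jump j -> exec t j l M -> exec t.+1 i l M.
Proof.
move=> pi; apply: exec_step => R Rl; exists R => //.
by rewrite /step /fetch /= pi.
Qed.

Lemma exec_jump_lt t i l M a b j :
  nth Halt p i = JumpLt a b j -> (a < size l) && (b < size l) ->
  exec t (if nth 0 l a < nth 0 l b then j else i.+1) l M -> exec t.+1 i l M.
Proof.
move=> pi /andP[al bl]; apply: exec_step => R Rl; exists R => //.
by rewrite /step /fetch /= pi !Rl.
Qed.

End Exec.

(** Program, address and length of the register list are concrete, so [reflexivity] selects the rule
    for the current instruction. Only the word bounds of [Const] and [Add] remain as side goals. *)
Ltac instr_step :=
  first [ eapply exec_const; [reflexivity | reflexivity | |]
        | eapply exec_add; [reflexivity | reflexivity | |]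
        | eapply exec_sub; [reflexivity | reflexivity |]
        | eapply exec_read; [reflexivity | reflexivity |]
        | eapply exec_write; [reflexivity | reflexivity |]
        | eapply exec_jump; [reflexivity |]
        | eapply exec_jump_lt; [reflexivity | reflexivity |] ];
  rewrite /=; rewrite ?add0n ?addn0 ?addn1.

(** * Invariants and running times of the loops *)

Section Phases.
Variables (W : nat) (Q : state -> Prop).
Local Notation exec := (exec mstp_program W Q).

(** Positivity tells the entries from the terminating 0. An entry costs five steps and the
    terminator four. *)
Lemma parse_list s t n v d x m a z pos M :
  all (fun y => 0 < y) s ->
  (forall j, j < size s -> M (pos + j) = nth 0 s j) -> M (pos + size s) = 0 ->
  pos + size s < W -> d + size s < W -> 0 < W ->
  (exec t 12 [:: 0; 1; n; (pos + size s).+1; v; d + size s; 0; m; a; z] M) ->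
  exec (5 * size s + 4 + t) 6 [:: 0; 1; n; pos; v; d; x; m; a; z] M.
Proof.
elim: s pos d x => [|y s IHs] pos d x /=.
  move=> _ _; rewrite !addn0 => M0 pW dW W0 ex.
  instr_step; instr_step; first lia.
  by rewrite M0; instr_step; instr_step; apply: ex.
move=> /andP[y0 s0] Ms M0 pW dW W0 ex.
have My : M pos = y by have := Ms 0 isT; rewrite addn0.
rewrite (_ : _ + t = (5 * size s + 4 + t).+4.+1); last lia.
instr_step; instr_step; first lia.
rewrite My; instr_step; rewrite y0; instr_step; first lia.
instr_step; apply: IHs; rewrite ?addSnnS //.
by move=> j js; rewrite addSnnS; apply: Ms.
Qed.

(** The degree of vertex [v] goes to cell [v.+1], which [v < pos] places among the cells already
    read once its list is consumed. Each list has a terminator, so [pos] stays ahead of [v]. A list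
    [s] costs [5 * size s + 9] steps, at most ten per cell. *)
Lemma parse_lists ls t pos v d x M :
  let flat := flatten [seq rcons s 0 | s <- ls] in
  all (all (fun y => 0 < y)) ls ->
  (forall j, M (pos + j) = nth 0 flat j) ->
  v < pos -> pos + size flat < W ->
  (forall M' d' x',
    (forall j, j < size ls -> M' (v + j).+1 = size (nth [::] ls j)) ->
    (forall j, j <= v -> M' j = M j) ->
    (forall j, M' (pos + size flat + j) = 0) ->
    exec t 15 [:: 0; 1; v + size ls; pos + size flat; v + size ls; d'; x';
                  0; 0; 0] M') ->
  exec (10 * size flat + 2 + t) 3
    [:: 0; 1; v + size ls; pos; v; d; x; 0; 0; 0] M.
Proof.
elim: ls pos v d x M => [|s ls IHls] pos v d x M flat /=.
  move=> _ Mf vpos posW ex; rewrite muln0 addn0.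
  instr_step; rewrite ltnn; instr_step.
  have := ex M d x; rewrite !addn0; apply=> // j.
  by rewrite Mf nth_nil.
move=> /andP[s0 ls0] Mf vpos posW ex.
set flat' := flatten [seq rcons s 0 | s <- ls].
have flatE : flat = rcons s 0 ++ flat' by [].
have sflat : size flat = (size s).+1 + size flat'.
  by rewrite flatE size_cat size_rcons.
apply: (@exec_weaken _ _ _
  (5 * size s + 4 + (10 * size flat' + 2 + t).+3).+2).
  by rewrite sflat; lia.
have Mpos j : j < size s -> M (pos + j) = nth 0 s j.
  by move=> js; rewrite Mf flatE nth_cat size_rcons ltnS ltnW // nth_rcons js.
have Mend : M (pos + size s) = 0.
  by rewrite Mf flatE nth_cat size_rcons ltnSn nth_rcons ltnn eqxx.
instr_step; rewrite (_ : v < _); last lia.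
instr_step; first lia.
apply: parse_list => //; try lia.
instr_step; first lia.
instr_step; instr_step.
have posW' : (pos + size s).+1 + size flat' < W.
  by move: posW; rewrite sflat; lia.
rewrite -[v + _.+1]addSnnS; apply: IHls => //; try lia.
- move=> j; rewrite /upd (_ : _ == _ = false); last lia.
  rewrite -addnS -addnA Mf flatE nth_cat size_rcons (_ : _ < _ = false); last lia.
  by congr nth; lia.
- move=> M' d' x' M'ls M'v M'end.
  have -> : (pos + size s).+1 + size (flatten [seq rcons s0 0 | s0 <- ls]) =
      pos + size flat.
    by rewrite sflat -/flat'; lia.
  rewrite addSnnS; apply: ex.
  + case=> [_|j jls]; last by rewrite -addSnnS; apply: M'ls.
    by rewrite addn0 M'v // /upd eqxx.
  + by move=> j jv; rewrite M'v ?/upd; [rewrite (_ : _ == _ = false); lia | lia].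
  + move=> j; rewrite -(M'end j); congr (M' (_ + _)).
    by rewrite sflat -/flat'; lia.
Qed.

(** [B] is the base of the table of counters, indexed by degree; [n < B] keeps it apart from the
    degrees in cells 1 to [n]. *)
Variables (dg : nat -> nat) (n B : nat).
Hypotheses (dg_lt : forall i, i < n -> dg i < n) (n_lt_B : n < B)
  (B_lt_W : B + n < W).

Local Notation count_eq := (count_eq dg).
Local Notation count_ge := (count_ge dg n).
Local Notation rank := (rank dg n).
Local Notation max_rank_spec := (max_rank_spec dg n).

Lemma count_loop k t v d x a M :
  v + k = n ->
  (forall i, i < n -> M i.+1 = dg i) ->
  (forall j, j < n -> M (B + j) = count_eq j v) ->
  (forall M' d' x' a',
    (forall i, i < n -> M' i.+1 = dg i) ->
    (forall j, j < n -> M' (B + j) = count_eq j n) ->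
    exec t 25 [:: 0; 1; n; B; n; d'; x'; 0; a'; 0] M') ->
  exec (8 * k + 2 + t) 16 [:: 0; 1; n; B; v; d; x; 0; a; 0] M.
Proof.
elim: k v d x a M => [|k IHk] v d x a M vk Mdg Mc ex.
  rewrite addn0 in vk; subst v; rewrite muln0.
  by instr_step; rewrite ltnn; instr_step; apply: ex.
rewrite (_ : _ + t = (8 * k + 2 + t).+4.+4); last lia.
have vn : v < n by lia.
have dvn := dg_lt _ vn.
have cn := count_eq_le dg (dg v) v.
instr_step; rewrite vn; instr_step; first lia.
instr_step; rewrite Mdg //; instr_step; first lia.
instr_step; rewrite Mc //; instr_step; first lia.
instr_step; instr_step; apply: IHk => //; first lia.
- by move=> i iN; rewrite /upd (_ : _ == _ = false) ?Mdg //; lia.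
- move=> j jn; rewrite /upd eqn_add2l count_eqS [dg v == j]eq_sym.
  by case: eqP => [->|_]; rewrite ?addn1 ?addn0 ?Mc.
Qed.

(** Cell [B + d] changes from the number of vertices of degree [d] to the number of larger degree,
    the offset of the block of degree [d]. Register 9 carries [count_ge d]. *)
Lemma prefix_loop k t d x y m a M :
  d + k = n ->
  (forall i, i < n -> M i.+1 = dg i) ->
  (forall j, j < n ->
    M (B + j) = if j < d then count_ge j.+1 else count_eq j n) ->
  m <= d -> max_rank_spec m d ->
  (forall M' x' m' a' z',
    (forall i, i < n -> M' i.+1 = dg i) ->
    (forall j, j < n -> M' (B + j) = count_ge j.+1) ->
    m' <= n -> max_rank_spec m' n ->
    exec t 38 [:: 0; 1; n; B; n; y; x'; m'; a'; z'] M') ->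
  exec (9 * k + 2 + t) 27 [:: 0; 1; n; B; d; y; x; m; a; count_ge d] M.
Proof.
elim: k d x m a M => [|k IHk] d x m a M dk Mdg Mc md ms ex.
  rewrite addn0 in dk; subst d; rewrite muln0.
  instr_step; rewrite ltnn; instr_step; apply: ex => // j jn.
  by rewrite Mc // jn.
rewrite (_ : _ + t = (9 * k + 2 + t).+4.+4.+1); last lia.
have dn : d < n by lia.
have cn := count_ge_le dg n d.
have upd_dg v i : i < n -> upd M (B + d) v i.+1 = dg i.
  by move=> iN; rewrite /upd (_ : _ == _ = false) ?Mdg //; lia.
have upd_c j : j < n -> upd M (B + d) (count_ge d.+1) (B + j) =
    if j < d.+1 then count_ge j.+1 else count_eq j n.
  move=> jn; rewrite /upd eqn_add2l; case: eqP => [->|jd]; first by rewrite ltnSn.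
  rewrite Mc // (_ : (j < d.+1) = (j < d)) //; lia.
instr_step; rewrite dn; instr_step; first lia.
(* If [d < count_ge d], register 7 becomes [d.+1]. As [d] increases, the last such update yields the
   maximum. *)
instr_step; case: (ltnP d (count_ge d)) => dc.
  instr_step; first lia.
  instr_step; rewrite Mc // ltnn; instr_step; rewrite count_geS; instr_step.
  instr_step; first lia.
  instr_step; apply: (IHk _ _ _ _ _ _ (upd_dg _) upd_c _ _ ex); try lia.
  by split=> // j jd _; lia.
instr_step; instr_step; rewrite Mc // ltnn; instr_step; rewrite count_geS.
instr_step.
instr_step; first lia.
instr_step; apply: (IHk _ _ _ _ _ _ (upd_dg _) upd_c _ _ ex); try lia.
case: ms => ms1 ms2; split=> // j.
rewrite ltnS leq_eqVlt => /predU1P[-> | /ms2 //].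
by rewrite ltnNge dc.
Qed.

(** The cell of degree [j] holds the last position used in its block, so its increment is the rank
    of the next vertex of that degree. The part index then overwrites the degree, which has just
    been read for the last time. *)
Lemma assign_loop k t v d x m a z M :
  v + k = n ->
  (forall i, i < n -> M i.+1 =
    if i < v then if m < rank i then 1 else rank i else dg i) ->
  (forall j, j < n -> M (B + j) = count_ge j.+1 + count_eq j v) ->
  (forall M' d' x' a',
    (forall i, i < n -> M' i.+1 = if m < rank i then 1 else rank i) ->
    exec t 52 [:: 0; 1; n; B; n; d'; x'; m; a'; z] M') ->
  exec (11 * k + 2 + t) 39 [:: 0; 1; n; B; v; d; x; m; a; z] M.
Proof.
elim: k v d x a M => [|k IHk] v d x a M vk Mdg Mc ex.
  rewrite addn0 in vk; subst v; rewrite muln0.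
  instr_step; rewrite ltnn; instr_step; apply: ex => i iN.
  by rewrite Mdg // iN.
rewrite (_ : _ + t = (11 * k + 2 + t).+4.+4.+3); last lia.
have vn : v < n by lia.
have dvn := dg_lt _ vn.
have cn := count_eq_le dg (dg v) v.
have cn' := count_ge_le dg n (dg v).+1.
instr_step; rewrite vn; instr_step; first lia.
instr_step; rewrite Mdg // ltnn; instr_step; first lia.
instr_step; rewrite Mc //; instr_step; first lia.
rewrite -rankE; instr_step.
set M1 := upd M _ _.
(* Both branches meet at address 50 with the part index [w] in register 6. *)
have H w : w = (if m < rank v then 1 else rank v) ->
  exec (11 * k + 2 + t).+2 50 [:: 0; 1; n; B; v.+1; dg v; w; m; B + dg v; z] M1.
  move=> wE; instr_step; instr_step; apply: IHk => //; first lia.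
    move=> i iN; rewrite /M1 /upd eqSS; case: eqP => [->|iv].
      by rewrite ltnSn.
    rewrite (_ : _ == _ = false); last lia.
    by rewrite Mdg // (_ : (i < v.+1) = (i < v)) //; lia.
  move=> j jn; rewrite /M1 /upd (_ : _ == _ = false); last lia.
  rewrite eqn_add2l count_eqS [dg v == j]eq_sym; case: eqP => [->|_].
    by rewrite rankE addn1 addnS.
  by rewrite addn0 Mc.
instr_step; case: ltnP H => _ H.
  instr_step; [lia | exact: H].
by instr_step; apply: H.
Qed.

Lemma sort_phases t d x M :
  (forall i, i < n -> M i.+1 = dg i) ->
  (forall j, M (B + j) = 0) ->
  (forall R M' m, max_rank_spec m n -> m <= n -> M' 0 = m ->
    (forall i, i < n -> M' i.+1 = if m < rank i then 1 else rank i) ->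
    Q (State 53 R M')) ->
  exec (28 * n + 12 + t) 15 [:: 0; 1; n; B; n; d; x; 0; 0; 0] M.
Proof.
move=> Mdg M0 q.
apply: (@exec_weaken _ _ _
  (8 * n + 2 + (9 * n + 2 + (11 * n + 2 + 2).+1).+2).+1); first lia.
instr_step => //; apply: count_loop => // M2 d2 x2 a2 Mdg2 Mc2.
instr_step => //; instr_step; first lia.
have ge0 : n = count_ge 0 by rewrite /count_ge count_predT size_iota.
(* Only the [n] in register 9 is rewritten, to match the invariant [count_ge d] at [d = 0]. *)
rewrite {4}ge0.
apply: prefix_loop => // M3 x3 m3 a3 z3 Mdg3 Mc3 mn ms.
instr_step => //; apply: assign_loop => // [j jn|M4 d4 x4 a4 M4r].
  by rewrite Mc3 // addn0.
instr_step; apply: exec_done => R _; exact: q ms mn _ _.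
Qed.

End Phases.

Lemma leq_size_flatten_rcons (T : Type) (x : T) (ls : seq (seq T)) :
  size ls <= size (flatten [seq rcons s x | s <- ls]).
Proof. by elim: ls => //= s ls IHls; rewrite size_cat size_rcons; lia. Qed.

Lemma mstp_program_exec W (Q : state -> Prop) (ls : seq (seq nat)) :
  let n := size ls in
  let dg i := size (nth [::] ls i) in
  let flat := flatten [seq rcons s 0 | s <- ls] in
  all (all (fun y => 0 < y)) ls ->
  (forall i, i < n -> dg i < n) -> 1 + size flat + n < W ->
  (forall R M m, max_rank_spec dg n m n -> m <= n -> M 0 = m ->
    (forall i, i < n -> M i.+1 = if m < rank dg n i then 1 else rank dg n i) ->
    Q (State 53 R M)) ->
  exec mstp_program W Q (38 * size flat + 19) 0 (nseq 10 0) (nth 0 (n :: flat)).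
Proof.
move=> n dg flat ls0 dgn Wn q.
(* The terminators alone fill [n] cells, so time linear in [n] is absorbed by the input length. *)
have nf : n <= size flat := leq_size_flatten_rcons _ 0 ls.
apply: (@exec_weaken _ _ _ (10 * size flat + 2 + (28 * n + 12 + 2)).+3).
  by move: (size flat) nf => f; clearbody n; lia.
have fW : 1 + size flat < W by lia.
instr_step; first lia.
instr_step; instr_step; first lia.
rewrite -[n]add0n; apply: parse_lists => // M d x Mdg _ M0.
rewrite !add0n; apply: (@sort_phases _ _ dg) => //; lia.
Qed.

(** * Input length and the linear bound *)

Lemma sum_deg_le n (e : rel 'I_n) : simple_graph e ->
  \sum_(v < n) deg e v <= 2 * #|edges e|.
Proof.
move=> [esym eirr].
(* Handshake: each edge is represented by its increasing pair, and the degree sum counts every such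
   pair once from each end. *)
pose A := [set p : 'I_n * 'I_n | e p.1 p.2 && (p.1 < p.2)].
have cA : #|A| <= #|edges e|.
  have fI : {in A &, injective (fun p : 'I_n * 'I_n => [set p.1; p.2])}.
    move=> [a b] [c d]; rewrite !inE /= => /andP[_ ab] /andP[_ cd] /setP E.
    have := E a; have := E b; have := E c; have := E d.
    rewrite !inE !eqxx !orbT -!val_eqE /= => *.
    by congr pair; apply: val_inj => /=; lia.
  rewrite -(card_in_imset fI); apply/subset_leq_card/subsetP => _ /imsetP[p + ->].
  by rewrite inE => /andP[ep _]; apply/imsetP; exists p; rewrite ?inE.
have sA : \sum_(v < n) \sum_(u < n | v < u) e v u = #|A|.
  rewrite -sum1_card pair_big_dep /= big_mkcond [RHS]big_mkcond /=.
  by apply: eq_bigr => -[v u] _; rewrite inE /=; case: (e v u); case: (v < u).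
have sA' : \sum_(v < n) \sum_(u < n | u < v) e v u = #|A|.
  rewrite -sA (exchange_big_dep predT) //=; apply: eq_bigr => u _.
  by apply: eq_bigr => v _; rewrite esym.
suff -> : \sum_(v < n) deg e v = #|A| + #|A| by lia.
rewrite -{1}sA -sA' -big_split; apply: eq_bigr => v _ /=.
rewrite /deg -sum1_card (bigID (fun u : 'I_n => v < u)) /=; congr addn.
  rewrite big_mkcond [RHS]big_mkcond; apply: eq_bigr => u _ /=; rewrite inE.
  by case: (e v u); case: (v < u).
rewrite big_mkcond [RHS]big_mkcond; apply: eq_bigr => u _ /=; rewrite inE.
case: ltngtP; case evu: (e v u) => //= uv.
by move: evu; rewrite (val_inj uv) eirr.
Qed.

Theorem theorem11 :
  exists (p : program) (c : nat),
  forall (n : nat) (e : rel 'I_n) (adj : 'I_n -> seq 'I_n),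
    simple_graph e -> split_graph e -> adjacency_lists e adj ->
    exists2 s : state,
      halts_within p (c * graph_size e) (c * graph_size e)
        (encode_graph adj) s
      & maximum_strong_transitive_partition e
          (decode_partition n (memory s)).
Proof.
(* The run takes at most [38 * size flat + 19] steps, where [flat], the encoded lists, has length at
   most [n + 2 * #|edges e|]; hence 76 = 2 * 38. The same bound exceeds every address used. *)
exists mstp_program, 76 => n e adj gS splitG adjP.
set T := 76 * graph_size e.
pose ls := [seq [seq (val u).+1 | u <- adj v] | v <- enum 'I_n].
pose dg i := size (nth [::] ls i).
have sls : size ls = n by rewrite size_map size_enum_ord.
have sadj v : size (adj v) = deg e v.
  by have [u_adj adjE] := adjP v; rewrite -(card_uniqP u_adj); apply: eq_card.
have dgE (v : 'I_n) : dg v = deg e v.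
  rewrite /dg (nth_map v) ?size_enum_ord // size_map sadj.
  by congr deg; apply: val_inj; rewrite /= nth_enum_ord.
have sflat : size (flatten [seq rcons s 0 | s <- ls]) <= n + 2 * #|edges e|.
  rewrite size_flatten /shape -!map_comp sumnE big_map -enumT big_enum /=.
  under eq_bigr do rewrite size_rcons size_map sadj -add1n.
  by rewrite big_split /= sum1_card card_ord leq_add2l sum_deg_le.
have deg_lt (v : 'I_n) : deg e v < n.
  have [_ eirr] := gS.
  rewrite -[X in _ < X]card_ord; apply: proper_card; apply/properP; split.
    exact/subsetP.
  by exists v; rewrite ?inE ?eirr.
pose Q s := halted mstp_program s /\
  maximum_strong_transitive_partition e (decode_partition n (memory s)).
have ls_pos : all (all (fun y => 0 < y)) ls.
  by apply/allP => _ /mapP[v _ ->]; apply/allP => _ /mapP[u _ ->].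
have dg_lt i : i < size ls -> dg i < size ls.
  by rewrite sls => iN; rewrite (dgE (Ordinal iN)).
have T_big : 1 + size (flatten [seq rcons s 0 | s <- ls]) + size ls < T.
  by rewrite sls /T /graph_size; lia.
have Qend R M m : max_rank_spec dg (size ls) m (size ls) -> m <= size ls ->
    M 0 = m ->
    (forall i, i < size ls ->
      M i.+1 = if m < rank dg (size ls) i then 1 else rank dg (size ls) i) ->
    Q (State 53 R M).
  rewrite sls => mspec mn Mm Mr; subst m; split=> //=.
  exact: decode_partition_maximum mspec mn Mr.
have [|t tT [s rs [hs ms]]] :=
    mstp_program_exec T Q ls ls_pos dg_lt T_big Qend (fun=> 0).
  by move=> a al; rewrite nth_nseq al.
exists s => //; exists t.
  by apply: leq_trans tT _; rewrite /T /graph_size; lia.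
split=> //; move: rs; rewrite /initial_state /encode_graph sls.
by rewrite /ls -map_comp.
Qed.
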